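(* Let $G$ be a topological group whose underlying topological space is a Cantor set. Then there is an abelian topological group structure on the same topological space $G$ whose (normalized) Haar measure is equal to the (normalized) Haar measure of the original topological group structure on $G$.
   Context: A Cantor set is a nonempty compact Hausdorff zero-dimensional space that has a countable base for its topology and in which every point is a limit point. A topological group is a $T_1$ (hence Hausdorff) space with a group structure for which multiplication and inversion are continuous. Haar measure on a compact group is the unique left translation invariant Borel measure $\mu$ normalized to be a probability measure. *)

(* Defs.v *)
From mathcomp Require Import all_boot all_order all_algebra.
From mathcomp Require Import all_classical all_reals all_analysis.

Set Implicit Arguments.
Unset Strict Implicit.
Unset Printing Implicit Defensive.

Local Open Scope classical_set_scope.

(* Zero-dimensional means that the clopen sets form a base.  The library's
   [zero_dimensional] only asks that clopen sets separate points, which agrees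
   with this for compact Hausdorff spaces but is weaker in general.
   Nonemptiness is carried by the pointed type. *)
Record cantor_set (T : ptopologicalType) : Prop := CantorSet {
  cantor_set_compact : compact [set: T];
  cantor_set_hausdorff : hausdorff_space T;
  cantor_set_zero_dimensional : basis (@clopen T);
  cantor_set_second_countable : @second_countable T;
  cantor_set_limit_point : forall x : T, limit_point [set: T] x
}.

(* The group structure is a record over a fixed space, rather than an
   HB structure, because two structures on the same space are compared.  The
   base point of T plays no role and need not be the identity. *)
Record topological_group (T : ptopologicalType) := TopologicalGroup {
  tg_mul : T -> T -> T;
  tg_one : T;
  tg_inv : T -> T;
  tg_mulA : associative tg_mul;
  tg_mul1g : left_id tg_one tg_mul;
  tg_mulg1 : right_id tg_one tg_mul;
  tg_mulVg : left_inverse tg_one tg_inv tg_mul;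
  tg_mulgV : right_inverse tg_one tg_inv tg_mul;
  tg_T1 : accessible_space T;
  tg_mul_continuous : continuous (fun xy : T * T => tg_mul xy.1 xy.2);
  tg_inv_continuous : continuous tg_inv
}.

Definition tg_abelian (T : ptopologicalType) (G : topological_group T) : Prop :=
  commutative (tg_mul G).

Definition borel (T : ptopologicalType) := g_sigma_algebraType (@open T).

Definition haar_measure (T : ptopologicalType) (G : topological_group T)
    (R : realType) (mu : probability (borel T) R) : Prop :=
  forall (g : T) (A : set (borel T)),
    measurable A -> mu (tg_mul G g @` A) = mu A.

(* Main.v *)
(* Choose clopen neighbourhoods V_0, V_1, ... of the identity of G shrinking to
   it.  The points x, y with "z x in V_i iff z y in V_i for all z and i < n"
   form nested left-invariant equivalence relations E_n with finitely many open
   classes, and these classes form a base of the topology.  By left invariance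
   all classes of E_n split into the same number k_n of classes of E_(n+1);
   numbering the parts identifies the space with the product of the cyclic
   groups Z/k_n so that E_n means agreement of the first n coordinates.  The
   product group is abelian and also leaves every E_n invariant.  Finally, for
   any group structure leaving the E_n invariant, a probability measure is Haar
   iff all classes of E_n have the same measure, for each n, a condition that
   does not mention the group. *)
Require Import Defs.
From mathcomp Require Import all_boot all_order all_algebra finmap.
From mathcomp Require Import all_classical all_reals all_analysis.

Set Implicit Arguments.
Unset Strict Implicit.
Unset Printing Implicit Defensive.

Import Order.TTheory GRing.Theory.

Local Open Scope classical_set_scope.

(** * Group identities and translations *)

Section group_identities.
Context {T : ptopologicalType} (G : topological_group T).

Lemma tg_mulKg g : cancel (tg_mul G g) (tg_mul G (tg_inv G g)).
Proof. by move=> x; rewrite tg_mulA tg_mulVg tg_mul1g. Qed.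

Lemma tg_mulKVg g : cancel (tg_mul G (tg_inv G g)) (tg_mul G g).
Proof. by move=> x; rewrite tg_mulA tg_mulgV tg_mul1g. Qed.

Lemma tg_mull_continuous g : continuous (tg_mul G g).
Proof.
move=> x.
apply: (@continuous_comp _ _ _ (pair g) (fun xy => tg_mul G xy.1 xy.2)).
  exact: (cvg_pair (cvg_cst _) cvg_id).
exact: tg_mul_continuous.
Qed.

Lemma image_tg_mul g (A : set T) :
  tg_mul G g @` A = tg_mul G (tg_inv G g) @^-1` A.
Proof.
apply/seteqP; split => [_ [x Ax <-]|x Ax] /=; first by rewrite tg_mulKg.
by exists (tg_mul G (tg_inv G g) x) => //; rewrite tg_mulKVg.
Qed.

End group_identities.

(** * Nested open equivalence relations on a compact space *)

(* [E n x] is the class of [x] at level [n]. *)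
Record open_tree (T : topologicalType) (E : nat -> T -> set T) : Prop :=
  OpenTree {
  otree_refl : forall n x, E n x x;
  otree_sym : forall n x y, E n x y -> E n y x;
  otree_trans : forall n x y z, E n x y -> E n y z -> E n x z;
  otree0 : forall x y, E 0%N x y;
  otree_decr : forall n x y, E n.+1 x y -> E n x y;
  otree_open : forall n x, open (E n x);
  otree_base : forall x U, nbhs x U -> exists n, E n x `<=` U }.

Definition left_invariant (T : ptopologicalType) (G : topological_group T)
    (E : nat -> T -> set T) : Prop :=
  forall n g x y, E n x y -> E n (tg_mul G g x) (tg_mul G g y).

Section open_tree_theory.
Context {T : ptopologicalType} (E : nat -> T -> set T) (treeE : open_tree E).

Lemma otree_eq n x y : E n x y -> E n x = E n y.
Proof.
move=> xy; apply/seteqP; split => z; apply: otree_trans => //.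
exact: otree_sym.
Qed.

Lemma otree_le m n x y : (m <= n)%N -> E n x y -> E m x y.
Proof.
elim: n => [|n IH]; first by rewrite leqn0 => /eqP ->.
rewrite leq_eqVlt => /predU1P[->//|mn /(otree_decr treeE)]; exact: IH.
Qed.

(** Two classes that meet are nested, the deeper one being the intersection. So the classes together
    with the empty set form a pi-system. *)
Lemma otree_setI m n x y : E m x `&` E n y = set0 \/
  exists k z, E m x `&` E n y = E k z.
Proof.
have [/eqP ->|/set0P[z [xz yz]]] := boolP (E m x `&` E n y == set0).
  by left.
right; exists (maxn m n), z; rewrite (otree_eq xz) (otree_eq yz).
apply/seteqP; split=> [w [mw nw]|w zw]; first by rewrite /maxn; case: ifP.
by split; apply: otree_le zw; rewrite ?leq_maxl ?leq_maxr.
Qed.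

(** The classes of one level are open, cover the space and are pairwise disjoint, so a finite
    subcover contains all of them. *)
Lemma otree_range_finite n : compact [set: T] -> finite_set (range (E n)).
Proof.
rewrite compact_cover => cT.
have [|x _|D _ TD] := cT T setT (E n); first by move=> x _; exact: otree_open.
  by exists x => //; exact: otree_refl.
have ED : range (E n) `<=` E n @` [set` D].
  move=> _ [x _ <-]; have [y Dy yx] := TD x I.
  by exists y => //; exact: otree_eq.
exact/(sub_finite_set ED)/finite_image/finite_fset.
Qed.

Lemma otree_separates : accessible_space T ->
  forall x y, (forall n, E n x y) -> x = y.
Proof.
move=> T1 x y Exy; apply: contrapT => /eqP /T1[A [oA]].
rewrite !inE => Ax nAy.
have [n EA] := otree_base treeE (open_nbhs_nbhs (conj oA Ax)).
exact/nAy/EA.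
Qed.

(** An open set is the union of the classes it contains; each level has only finitely many, so this
    union is countable. *)
Lemma borel_otree : compact [set: T] ->
  <<s @open T>> = <<s [set A | A = set0 \/ exists n x, A = E n x] >>.
Proof.
move=> cT; set C := (X in _ = <<s X>>).
have CE n x : @measurable _ (g_sigma_algebraType C) (E n x).
  by apply: sub_sigma_algebra; right; exists n, x.
apply/seteqP; split; apply: smallest_sub; try exact: smallest_sigma_algebra.
  move=> U oU.
  have -> : U = \bigcup_n \bigcup_(A in range (E n) `&` [set A | A `<=` U]) A.
    apply/seteqP; split => [x Ux|x [n _ [A [_ AU]]]]; last exact: AU.
    have [n EU] := otree_base treeE (open_nbhs_nbhs (conj oU Ux)).
    by exists n => //; exists (E n x); [split=> //; exists x|exact: otree_refl].
  suff : @measurable _ (g_sigma_algebraType C)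
    (\bigcup_n \bigcup_(A in range (E n) `&` [set A | A `<=` U]) A) by [].
  apply: bigcupT_measurable => n; apply: fin_bigcup_measurable.
    by apply: finite_setIl; exact: otree_range_finite.
  by move=> A [[x _ <-] _].
move=> A [->|[n [x ->]]]; first exact: (@measurable0 _ (borel T)).
by apply: sub_sigma_algebra; exact: otree_open.
Qed.

End open_tree_theory.

(** * Haar measure read off an invariant tree *)

Section haar_open_tree.
Context {R : realType} {T : ptopologicalType} (G : topological_group T).
Context (E : nat -> T -> set T) (treeE : open_tree E).
Context (invE : left_invariant G E).

Lemma preimage_left_invariant n g x :
  tg_mul G (tg_inv G g) @^-1` E n x = E n (tg_mul G g x).
Proof.
apply/seteqP; split => y /=.
  by move=> /(@invE n g); rewrite tg_mulKVg.
by move=> /(@invE n (tg_inv G g)); rewrite tg_mulKg.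
Qed.

(** Translations permute the classes of a level transitively, so Haar measure gives them equal mass.
    Conversely, equal masses make [mu] and its translates agree on a pi-system generating the Borel
    sets. *)
Lemma haar_measureP (mu : probability (borel T) R) : compact [set: T] ->
  haar_measure G mu <-> forall n x y, mu (E n x) = mu (E n y).
Proof.
move=> cT.
have mE n x : measurable (E n x : set (borel T)).
  by apply: sub_sigma_algebra; exact: otree_open.
split=> [haar n x y|muE g A mA].
  rewrite -(haar (tg_mul G y (tg_inv G x))) // image_tg_mul.
  by rewrite preimage_left_invariant -tg_mulA tg_mulVg tg_mulg1.
rewrite image_tg_mul.
have mf : measurable_fun [set: borel T]
    (tg_mul G (tg_inv G g) : borel T -> borel T).
  apply: (@measurability _ _ (borel T) (borel T) _ _ (@open T)) => //.
  move=> _ [U oU <-]; rewrite setTI.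
  apply: sub_sigma_algebra; apply: open_comp => // x _.
  exact: tg_mull_continuous.
(* Level 0 has a single class, the whole space, so a constant sequence is the exhaustion by sets of
   finite measure that uniqueness asks for. *)
have uniq := @measure_unique _ R (borel T) _ (fun=> E 0%N point)
  (borel_otree treeE cT).
rewrite -[LHS]/(pushforward mu (tg_mul G (tg_inv G g) : borel T -> borel T) A).
apply: uniq => //.
- move=> _ B [->|[m [x ->]]]; first by rewrite set0I; left.
  move=> [->|[n [y ->]]]; first by rewrite setI0; left.
  exact: otree_setI.
- by right; exists 0%N, point.
- apply/seteqP; split=> // x _; exists 0%N => //; exact: otree0.
- move=> B [->|[n [x ->]]]; first by rewrite !measure0.
  by rewrite /= /pushforward preimage_left_invariant; exact: muE.
- move=> _; rewrite /= /pushforward preimage_left_invariant.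
  by rewrite (le_lt_trans (probability_le1 mu _)) ?ltry.
Qed.

End haar_open_tree.

(** * An invariant tree in a compact zero-dimensional group *)

Section compact_group.
Context {T : ptopologicalType} (G : topological_group T).
Context (compactT : compact [set: T]).

(* When [V] is a clopen neighbourhood of the identity, this is the left coset
   through [x] of an open subgroup contained in [V]. *)
Definition clopen_coset (V : set T) (x : T) : set T :=
  [set y | forall z, V (tg_mul G z x) <-> V (tg_mul G z y)].

Lemma clopen_coset_open (V : set T) x : clopen V -> open (clopen_coset V x).
Proof.
move=> [oV cV]; rewrite openE => y xy.
(* By compactness, it suffices to treat each z locally. *)
suff : \forall y' \near y,
    [set: T] `<=` [set z | V (tg_mul G z y) <-> V (tg_mul G z y')].
  by apply: filterS => y' Vy' z; rewrite (xy z); exact: Vy'.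
apply: (compact_near_coveringP _).1 => // z _.
(* Used for [V] and for its complement: whichever contains [z y] also contains [z' y] and [z' y']
   nearby, which gives the equivalence there. *)
have near_mul W : open W -> W (tg_mul G z y) ->
    \forall z' \near z & y' \near y, W (tg_mul G z' y) /\ W (tg_mul G z' y').
  move=> oW Wzy; have [[A B] [/= zA yB] AB] :=
    @tg_mul_continuous _ G (z, y) W (open_nbhs_nbhs (conj oW Wzy)).
  exists (A, B) => // -[z' y'] [/= Az' By'].
  split; [apply: (AB (z', y))|exact: (AB (z', y'))].
  by split=> //; exact: nbhs_singleton.
have [Vzy|nVzy] := pselect (V (tg_mul G z y)).
  by apply: filterS (near_mul V oV Vzy) => -[z' y'] /= [? ?]; split.
apply: filterS (near_mul _ (closed_openC cV) nVzy) => -[z' y'] /= [? ?].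
by split.
Qed.

Lemma invariant_open_tree : basis (@clopen T) -> @second_countable T ->
  exists2 E, open_tree E & left_invariant G E.
Proof.
move=> clopenB [B /countable_injP[f injf] [oB nbhsB]].
(* [f] numbers the base. [V n] refines the basic neighbourhood of the identity with number [n], and
   is [setT] if there is none. *)
have exV n : exists V : set T, clopen V /\
    forall U, B U -> U (tg_one G) -> f U = n -> V (tg_one G) /\ V `<=` U.
  have [[U [BU U1 fU]]|noU] :=
    pselect (exists U, [/\ B U, U (tg_one G) & f U = n]).
    have [V [clV V1] VU] := clopenB.2 _ _ (open_nbhs_nbhs (conj (oB _ BU) U1)).
    exists V; split=> // U' BU' U'1 fU'; suff -> : U' = U by [].
    by apply: injf; rewrite ?inE // fU.
  exists setT; split; first by split; [exact: openT|exact: closedT].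
  by move=> U BU U1 fU; exfalso; apply: noU; exists U.
have [V V_spec] := choice exV.
pose E n x := [set y | forall i, (i < n)%N -> clopen_coset (V i) x y].
exists E; last by move=> n g x y xy i /xy {}xy z; rewrite !tg_mulA.
split.
- by [].
- by move=> n x y xy i /xy {}xy z; split => /xy.
- by move=> n x y z xy yz i ltin v; rewrite (xy i ltin v); exact: yz.
- by [].
- by move=> n x y xy i ltin; apply: xy; exact: ltnW.
- elim=> [|n IH] x.
    by rewrite (_ : E 0%N x = setT); [exact: openT|apply/seteqP; split].
  rewrite (_ : E n.+1 x = E n x `&` clopen_coset (V n) x).
    by apply: openI => //; exact/clopen_coset_open/(V_spec n).1.
  apply/seteqP; split=> [y xy|y [xy xyn] i].
    by split=> [i ltin|]; apply: xy => //; exact: ltnW.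
  by rewrite ltnS leq_eqVlt => /predU1P[->|/xy].
- move=> x W xW.
  have : nbhs (tg_one G) (tg_mul G x @^-1` W).
    by apply: tg_mull_continuous; rewrite tg_mulg1.
  (* Level [(f U).+1] is the first to involve [V (f U)]; its condition is tested at [z = x^-1],
     which moves [x] to the identity. *)
  move=> /nbhsB[U [BU U1] UW]; exists (f U).+1 => y.
  move=> /(_ _ (ltnSn _)) /(_ (tg_inv G x)).
  have [V1 VU] := (V_spec (f U)).2 U BU U1 erefl.
  by rewrite tg_mulVg => /iffLR/(_ V1)/VU/UW /=; rewrite tg_mulKVg.
Qed.

End compact_group.

(** * Labelling the parts of each class *)

Section coordinates.
Context {T : ptopologicalType} (E : nat -> T -> set T) (treeE : open_tree E).
Context (compactT : compact [set: T]).

(** Translations carry the level-n class of the identity onto every other one, so a numbering of its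
    parts can be transported to all of them. *)
Lemma left_invariant_labels (G : topological_group T) n : left_invariant G E ->
  exists k (c : T -> 'I_k.+1),
    (forall x y, E n.+1 x y <-> E n x y /\ c x = c y) /\
    (forall x i, exists2 y, E n x y & c y = i).
Proof.
move=> invE; pose Q := [set E n.+1 x | x in E n (tg_one G)].
have Q1 : Q (E n.+1 (tg_one G)) by exists (tg_one G) => //; exact: otree_refl.
have [k Qk] : exists k, (Q #= `I_k)%card.
  apply/finite_setP.
  apply: sub_finite_set (otree_range_finite treeE n.+1 compactT).
  by move=> _ [x _ <-]; exists x.
have /card_set_bijP[f [ftot finj fsurj]] := Qk.
(* [Q] is nonempty, so its cardinal is a successor, as the cyclic group on ['I_k.+1] requires. *)
case: k Qk ftot fsurj => [|k] Qk ftot fsurj; first by have := ftot _ Q1.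
(* [s x] is a representative of the level-n class of [x], so that [c] records
   the position of [x] relative to it. *)
pose s x := get (E n x).
have Es x : E n x (s x) by apply: (@getI _ _ x); exact: otree_refl.
pose d x : 'I_k.+1 := inord (f (E n.+1 x)).
pose c x := d (tg_mul G (tg_inv G (s x)) x).
have base x : E n (tg_one G) (tg_mul G (tg_inv G (s x)) x).
  by rewrite -(tg_mulVg G (s x)); apply: invE; apply: otree_sym.
have dP x y : E n (tg_one G) x -> E n (tg_one G) y -> d x = d y <-> E n.+1 x y.
  move=> x1 y1; split=> [|/(otree_eq treeE) xy]; last by rewrite /d xy.
  move=> /(congr1 val); rewrite /= !inordK; last 2 first.
    by apply: ftot; exists y.
    by apply: ftot; exists x.
  move=> fxy; suff -> : E n.+1 x = E n.+1 y by exact: otree_refl.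
  by apply: finj; rewrite ?inE //; [exists x|exists y].
exists k, c; split=> [x y|x i].
  suff cE : E n x y -> c x = c y <-> E n.+1 x y.
    split=> [xy|[xy /cE]]; last exact.
    by have nxy := otree_decr treeE xy; split=> //; exact/cE.
  (* Points of one level-n class share their representative, so the same translation moves both. *)
  move=> xy; rewrite dP // {1 2}/s (otree_eq treeE xy) -/(s y).
  split=> [/(@invE _ (s y))|xy1]; last exact: invE.
  by rewrite !tg_mulKVg.
have [_ [z z1 <-] fz] := fsurj i (ltn_ord i).
have xsz : E n x (tg_mul G (s x) z).
  apply: (otree_trans treeE) (Es x) _.
  by rewrite -{1}(tg_mulg1 G (s x)); exact: invE.
exists (tg_mul G (s x) z) => //.
rewrite /c /s -(otree_eq treeE xsz) -/(s x) tg_mulKg /d fz.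
exact: inord_val.
Qed.

(** * The space as a product of finite cyclic groups *)

Context (k : nat -> nat) (c : forall n, T -> 'I_(k n).+1).
Context (labelP : forall n x y, E n.+1 x y <-> E n x y /\ c n x = c n y).
Context (label_onto : forall n x i, exists2 y, E n x y & c n y = i).

Lemma otree_labels n x y : E n x y <-> forall i, (i < n)%N -> c i x = c i y.
Proof.
elim: n => [|n IH]; first by split=> // _; exact: otree0.
rewrite labelP IH; split=> [[xy cxy] i|xy].
  by rewrite ltnS leq_eqVlt => /predU1P[->//|/xy].
by split=> [i ltin|]; apply: xy => //; exact: ltnW.
Qed.

Lemma labels_inj : accessible_space T ->
  forall x y, (forall n, c n x = c n y) -> x = y.
Proof.
move=> T1 x y cxy; apply: (otree_separates treeE T1) => n.
exact/otree_labels.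
Qed.

(** Points [u n] with the first [n] coordinates prescribed are built one coordinate at a time; by
    compactness they have a cluster point, which has all of them. *)
Lemma labels_surj (a : forall n, 'I_(k n).+1) : exists x, forall n, c n x = a n.
Proof.
have exh (p : nat * T) : exists y, E p.1 p.2 y /\ c p.1 y = a p.1.
  by have [y] := label_onto p.2 (a p.1); exists y.
have [h hP] := choice exh.
pose fix u n := if n is m.+1 then h (m, u m) else point.
have uS n i : (i < n)%N -> c i (u n) = a i.
  elim: n => // n IH; rewrite ltnS leq_eqVlt => /predU1P[->|ltin].
    exact: (hP (n, u n)).2.
  by rewrite /= -(iffLR (otree_labels n _ _) (hP (n, u n)).1 i ltin) IH.
have [x [_ xcl]] :=
  compactT (fmap_proper_filter u _ : ProperFilter (u @ \oo)) filterT.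
exists x => n.
have xE : nbhs x (E n.+1 x).
  by apply: open_nbhs_nbhs; split; [exact: otree_open|exact: otree_refl].
(* By [uS], each [u m] with [n < m] has [n]-th coordinate [a n], and [E n.+1 x] is a neighbourhood
   on which that coordinate is constant. *)
have uge : (u @ \oo) (u @` [set m | (n < m)%N]).
  by exists n.+1 => // m /= ltnm; exists m.
have [_ [[m ltnm <-] /otree_labels xm]] := xcl _ _ uge xE.
by rewrite xm // uS.
Qed.

(** Addition modulo [(k n).+1] in each coordinate is transported to [T]. The first [n] coordinates
    of a sum depend only on those of the summands, which yields both continuity and invariance of
    [E]. *)
Lemma labels_abelian_group : accessible_space T ->
  exists2 H : topological_group T, tg_abelian H & left_invariant H E.
Proof.
move=> T1.
have /choice[p pK] := labels_surj.
have inj := labels_inj T1.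
pose mul x y := p (fun n => (c n x + c n y)%R).
pose one := p (fun n => 0%R).
pose inv x := p (fun n => (- c n x)%R).
have mulE n x y : c n (mul x y) = (c n x + c n y)%R by rewrite pK.
have oneE n : c n one = 0%R by rewrite pK.
have invE n x : c n (inv x) = (- c n x)%R by rewrite pK.
have mulA : associative mul.
  by move=> x y z; apply: inj => n; rewrite !mulE addrA.
have mulC : commutative mul by move=> x y; apply: inj => n; rewrite !mulE addrC.
have mul1 : left_id one mul.
  by move=> x; apply: inj => n; rewrite mulE oneE add0r.
have mulV : left_inverse one inv mul.
  by move=> x; apply: inj => n; rewrite mulE invE oneE addNr.
have mulr1 : right_id one mul by move=> x; rewrite mulC.
have mulVr : right_inverse one inv mul by move=> x; rewrite mulC.
have nbhsE n x : nbhs x (E n x).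
  by apply: open_nbhs_nbhs; split; [exact: otree_open|exact: otree_refl].
have mul_cont : continuous (fun xy : T * T => mul xy.1 xy.2).
  move=> [x y] W /(otree_base treeE)[n EW].
  exists (E n x, E n y); first by split; exact: nbhsE.
  move=> -[x' y'] [/= /otree_labels xx' /otree_labels yy'].
  by apply/EW/otree_labels => i ltin; rewrite !mulE xx' ?yy'.
have inv_cont : continuous inv.
  move=> x W /(otree_base treeE)[n EW].
  apply: filterS (nbhsE n x) => y /otree_labels xy.
  by apply/EW/otree_labels => i ltin; rewrite !invE xy.
exists (TopologicalGroup mulA mul1 mulr1 mulV mulVr T1 mul_cont inv_cont) => //.
move=> n g x y /otree_labels xy /=; apply/otree_labels => i ltin.
by rewrite !mulE xy.
Qed.

End coordinates.

Theorem theorem4 (R : realType) (T : ptopologicalType)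
    (G : topological_group T) (cantorT : cantor_set T) :
  exists H : topological_group T,
    tg_abelian H /\
    forall mu : probability (borel T) R,
      haar_measure G mu <-> haar_measure H mu.
Proof.
have [cT _ clopenB scT _] := cantorT.
have [E treeE invE] := invariant_open_tree G cT clopenB scT.
have labels n := left_invariant_labels treeE cT n invE.
have [k exc] := choice labels.
(* The type of the [n]-th labelling depends on [k n], so it is selected once [k] is fixed. *)
pose c n := projT1 (cid (exc n)); have cP n := projT2 (cid (exc n)) : _ (c n).
have [H abH invH] := labels_abelian_group treeE cT (fun n => (cP n).1)
  (fun n => (cP n).2) (tg_T1 G).
exists H; split=> // mu.
by rewrite (haar_measureP treeE invE) // (haar_measureP treeE invH).
Qed.
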